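(* For every $n\ge 1$, the two-pop-stack sortable permutations of length $n$ are in bijection with the polyominoes of size $n$ on a twisted cylinder of width $3$. Moreover, for every $k\ge 0$, there are exactly $a(n,k)$ polyominoes of size $n$ on a twisted cylinder of width $3$ that have exactly $k+1$ squares without an adjacent square (of the polyomino) to their right.
   Context: Permutations: $\mathcal{S}_n$ is the set of permutations of $\{1,\dots,n\}$, written as words. An ascent of $\pi$ is an index $i$ with $\pi_i<\pi_{i+1}$, and $\mathrm{asc}(\pi)$ is the number of ascents. For a word $\pi=\pi_1\cdots\pi_n$ of distinct integers with longest decreasing prefix $\pi_1\cdots\pi_i$, define recursively $P(\pi)=\pi_i\pi_{i-1}\cdots\pi_1\,P(\pi_{i+1}\cdots\pi_n)$, with $P$ of the empty word being empty (so $P$ reverses each maximal contiguous decreasing run). $\pi\in\mathcal{S}_n$ is two-pop-stack sortable if $P(P(\pi))=12\cdots n$; $\mathcal{P}_{2,n}$ is the set of such $\pi$, and $a(n,k)=|\{\pi\in\mathcal{P}_{2,n}:\mathrm{asc}(\pi)=k\}|$. Polyominoes on a twisted cylinder of width $w$: these are polyominoes (finite edge-connected sets of cells) on the surface obtained from the square lattice $\mathbb{Z}^2$ by identifying the cell $(x,y)$ with the cell $(x-w,y+1)$ for all $(x,y)$. Equivalently, the cells are indexed by integers, via $(x,y)\mapsto x+wy$; the cell to the right of cell $i$ is $i+1$, the cell above cell $i$ is $i+w$, and two cells are edge-adjacent if and only if their indices differ by $1$ or $w$. A polyomino of size $n$ is thus a connected set of $n$ cells under this adjacency, and polyominoes are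 counted up to translation (i.e. up to shifting all indices by a common integer). A square $i$ of a polyomino has no adjacent square to its right if cell $i+1$ is not in the polyomino. *)

(* Defs.v *)
From HB Require Import structures.
From mathcomp Require Import all_boot all_order all_algebra all_fingroup.
From mathcomp Require Import finmap.
From mathcomp Require Import classical_sets functions cardinality.

Set Implicit Arguments.
Unset Strict Implicit.
Unset Printing Implicit Defensive.

(* Length of the longest decreasing prefix (the empty prefix always qualifies). *)
Definition dec_prefix (s : seq nat) : nat :=
  \max_(i < (size s).+1 | sorted gtn (take i s)) i.

(* The first argument is fuel; [pop_stackE] is the intended recursion. *)
Fixpoint pop_stack_rec (m : nat) (s : seq nat) : seq nat :=
  if m is m'.+1 then
    if nilp s then [::]
    else rev (take (dec_prefix s) s) ++ pop_stack_rec m' (drop (dec_prefix s) s)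
  else [::].

Definition pop_stack (s : seq nat) : seq nat := pop_stack_rec (size s) s.

Lemma dec_prefix_gt0 (s : seq nat) : s != [::] -> 0 < dec_prefix s.
Proof.
case: s => // x s _.
have h : 1 < (size (x :: s)).+1 by [].
by apply: (@leq_trans (Ordinal h)) => //; apply: leq_bigmax_cond; rewrite /= take0.
Qed.

Lemma pop_stack_rec_fuel (m m' : nat) (s : seq nat) :
  size s <= m -> size s <= m' -> pop_stack_rec m s = pop_stack_rec m' s.
Proof.
elim: m m' s => [|m IH] [|m'] [|x s] //= hm hm'.
have h0 : 0 < dec_prefix (x :: s) by apply: dec_prefix_gt0.
have hs : size (drop (dec_prefix (x :: s)) (x :: s)) <= size s.
  by rewrite size_drop /= leq_subLR -add1n leq_add2r.
by rewrite (IH m') ?(leq_trans hs).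
Qed.

Lemma pop_stack_nil : pop_stack [::] = [::].
Proof. by []. Qed.

Lemma pop_stackE (s : seq nat) : s != [::] ->
  pop_stack s =
    rev (take (dec_prefix s) s) ++ pop_stack (drop (dec_prefix s) s).
Proof.
case: s => // x s hs; rewrite {1}/pop_stack /=; congr (_ ++ _).
apply: pop_stack_rec_fuel => //.
by rewrite size_drop /= leq_subLR -add1n leq_add2r; apply: dec_prefix_gt0.
Qed.

(* 'S_n permutes {0, ..., n-1}; the word is written on {1, ..., n}. *)
Definition perm_word (n : nat) (s : 'S_n) : seq nat :=
  [seq (nat_of_ord (s i)).+1 | i <- enum 'I_n].

Definition asc (s : seq nat) : nat :=
  #|[pred i : 'I_(size s).-1 | nth 0 s i < nth 0 s i.+1]|.

Definition two_pop_stack_sortable (n : nat) : {pred 'S_n} :=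
  [pred s : 'S_n | pop_stack (pop_stack (perm_word s)) == iota 1 n].
Arguments two_pop_stack_sortable : clear implicits.

Definition a (n k : nat) : nat :=
  #|[pred s : 'S_n | (s \in two_pop_stack_sortable n)
                     && (asc (perm_word s) == k)]|.

Local Open Scope fset_scope.
Local Open Scope ring_scope.

(* The integer i stands for the cell of the twisted cylinder of width w which
   is the class of all (x, y) in Z^2 with x + w y = i; such pairs are exactly
   those related by iterating (x, y) ~ (x - w, y + 1). *)
Definition cell_adj (w : nat) : rel int :=
  [rel i j : int | (`|i - j| == 1) || (`|i - j| == w%:Z)].

Definition cell_connected (w : nat) (A : {fset int}) : bool :=
  [forall u : A, forall v : A,
     connect [rel s t : A | cell_adj w (val s) (val t)] u v].

(* Not yet up to translation. *)
Definition polyomino (w n : nat) (A : {fset int}) : Prop :=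
  #|` A| = n /\ cell_connected w A.

Definition translate (c : int) (A : {fset int}) : {fset int} :=
  [fset i + c | i in A].

Definition translation_class (A : {fset int}) : set {fset int} :=
  [set B | exists c : int, B = translate c A]%classic.

Definition up_to_translation (X : set {fset int}) : set (set {fset int}) :=
  (translation_class @` X)%classic.

Definition num_right_free (A : {fset int}) : nat :=
  #|` [fset i in A | i + 1 \notin A]|.

(* Main.v *)
(* Both sides are encoded by words g of length n - 1 over {0, 1, 2} in which
   every letter 1 has a neighbouring letter 0.

   Polyominoes: g lists the numbers of missing cells between consecutive cells.
   Edges have length 1 or 3, so a gap has at most 2 missing cells; a gap of 0
   or 2 is itself an edge, and a gap of 1 is bridged by an edge of length 3
   exactly when one of the two runs of cells around it has length at least 2.

   Permutations: [pop_stack] reverses the maximal decreasing blocks of a word,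
   and reversing prescribed blocks is an involution.  Hence a sortable pi is
   recovered from the descent sets D1 of pi and D2 of [pop_stack pi], by
   reversing in the identity the blocks of D2 and then those of D1.  A pair
   (D1, D2) arises in this way if and only if D1 and D2 are disjoint and every
   element of D2 has a neighbour in D1; put 0 on D1, 1 on D2, 2 elsewhere.

   The nonzero letters are the ascents of pi, and also the gaps that end a run
   of cells, i.e. all cells but the last without a right neighbour. *)

Require Import Defs.
From mathcomp Require Import all_boot all_order all_algebra all_fingroup.
From mathcomp Require Import finmap.
From mathcomp Require Import classical_sets functions cardinality.
From mathcomp Require Import zify.

Import Order.TTheory GRing.Theory Num.Theory.

(** * Blocks of a mask and their reversal *)

(* A mask [D : nat -> bool] glues the positions [k] and [k.+1] when [D k]; its
   maximal chains of glued positions are intervals, called blocks. *)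
Definition block (D : nat -> bool) (l r : nat) : Prop :=
  [/\ l <= r, forall k, l <= k < r -> D k,
      forall k, k.+1 = l -> ~~ D k & ~~ D r].

Fixpoint block_start (D : nat -> bool) (j : nat) : nat :=
  if j is i.+1 then if D i then block_start D i else j else 0.

(* The first argument is fuel. *)
Fixpoint block_end (m : nat) (D : nat -> bool) (j : nat) : nat :=
  if m is m'.+1 then if D j then block_end m' D j.+1 else j else j.

(** Reflection [l + r - j] of [j] in its block [[l, r]]; [n] is the fuel for finding [r]. *)
Definition block_rev (n : nat) (D : nat -> bool) (j : nat) : nat :=
  block_start D j + block_end n D j - j.

Definition bounded_mask (n : nat) (D : nat -> bool) : Prop :=
  forall k, D k -> k.+1 < n.

Lemma block_startP D j : 
  [/\ block_start D j <= j, forall k, block_start D j <= k < j -> D k &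
      forall k, k.+1 = block_start D j -> ~~ D k].
Proof.
elim: j => [|j [IH1 IH2 IH3]] /=; first by split=> // k; lia.
case: ifP => Dj; split=> //.
- lia.
- move=> k; have [->//|nkj] := eqVneq k j; move=> h; apply: IH2; lia.
- lia.
by move=> k [->]; rewrite Dj.
Qed.

Lemma block_endP m n D j : bounded_mask n D -> n <= m + j ->
  [/\ j <= block_end m D j, forall k, j <= k < block_end m D j -> D k &
      ~~ D (block_end m D j)].
Proof.
move=> Dn; elim: m j => [|m IH] j hj /=.
  by split=> // [k|]; [lia|apply/negP => /Dn; lia].
case: ifP => Dj; last by split=> [//|k|]; [lia|rewrite Dj].
have [|h1 h2 h3] := IH j.+1; first lia.
split=> //; first lia.
by move=> k; have [->//|nkj] := eqVneq k j; move=> h; apply: h2; lia.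
Qed.

Lemma block_start_end n D j : bounded_mask n D ->
  block D (block_start D j) (block_end n D j).
Proof.
move=> Dn; have [h1 h2 h3] := block_startP D j.
have [|h4 h5 h6] := @block_endP n n D j Dn; first lia.
split=> //; first lia.
by move=> k hk; case: (ltnP k j) => kj; [apply: h2|apply: h5]; lia.
Qed.

(** A block starting or ending strictly inside the other would break a glued pair of the latter. *)
Lemma block_uniq D l r l' r' j : block D l r -> block D l' r' ->
  l <= j <= r -> l' <= j <= r' -> l = l' /\ r = r'.
Proof.
move=> [lr inD startD endD] [lr' inD' startD' endD'] hj hj'; split.
  case: (ltngtP l l') => // h.
    have := startD' l'.-1; rewrite inD ?prednK; lia.
  have := startD l.-1; rewrite inD' ?prednK; lia.
case: (ltngtP r r') => // h.
  by move: endD; rewrite inD' //; lia.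
by move: endD'; rewrite inD //; lia.
Qed.

Section BlockRev.
Variables (n : nat) (D : nat -> bool).
Hypothesis Dn : bounded_mask n D.

Lemma block_revE l r j : block D l r -> l <= j <= r ->
  block_rev n D j = l + r - j.
Proof.
move=> b hj; rewrite /block_rev.
have b' := block_start_end n D j Dn.
have [h1 _ _] := block_startP D j.
have [|h2 _ _] := @block_endP n n D j Dn; first lia.
have [|-> -> //] := block_uniq _ _ _ _ _ _ b' b _ hj; lia.
Qed.

(** The last clause keeps [block_rev] inside [[0, n)]: a block reaching beyond [j] ends just after a
    glued position. *)
Lemma in_block j : exists l r, [/\ block D l r, l <= j <= r & (j < n -> r < n)].
Proof.
have [h1 _ _] := block_startP D j.
have [|h2 h3 _] := @block_endP n n D j Dn; first lia.
exists (block_start D j), (block_end n D j); split; [exact: block_start_end|lia|].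
move=> jn; have [->//|ne] := eqVneq (block_end n D j) j.
have := @Dn (block_end n D j).-1; rewrite h3; lia.
Qed.

Lemma block_revK : involutive (block_rev n D).
Proof.
move=> j; have [l [r [b hj _]]] := in_block j.
rewrite (block_revE _ _ _ b hj) (block_revE _ _ _ b); lia.
Qed.

Lemma block_rev_lt j : j < n -> block_rev n D j < n.
Proof.
move=> jn; have [l [r [b hj hn]]] := in_block j.
rewrite (block_revE _ _ _ b hj); lia.
Qed.

(** Reflection reverses the order inside a block and preserves the order of distinct blocks, so the
    inversions are exactly the pairs in a common block. *)
Lemma block_rev_desc i j : i < j ->
  block_rev n D j < block_rev n D i <-> (forall k, i <= k < j -> D k).
Proof.
move=> ij; have [l [r [b hi _]]] := in_block i.
have [l' [r' [b' hj _]]] := in_block j.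
rewrite (block_revE _ _ _ b hi) (block_revE _ _ _ b' hj).
have [_ inD startD endD] := b; have [_ inD' startD' endD'] := b'.
case: (leqP j r) => jr.
  have [|<- <-] := block_uniq _ _ _ _ _ _ b b' _ hj; first lia.
  by split=> [_ k hk|_]; [apply: inD|]; lia.
split=> [lt_rev|allD]; last by move: endD; rewrite allD //; lia.
have : l' <= r by lia.
move=> l'r; move: endD; rewrite inD' //; lia.
Qed.

Lemma block_rev_desc1 i : (block_rev n D i.+1 < block_rev n D i) = D i.
Proof.
apply/idP/idP => [/(block_rev_desc i i.+1 (ltnSn i)) -> //|Di]; first lia.
apply/block_rev_desc => // k hk; have -> : k = i by lia. by [].
Qed.

Lemma block_rev_asc1 i : (block_rev n D i < block_rev n D i.+1) = ~~ D i.
Proof.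
by rewrite -block_rev_desc1 -leqNgt ltn_neqAle (can_eq block_revK) ltn_eqF.
Qed.

End BlockRev.

Lemma eq_block_rev n D D' : D =1 D' -> block_rev n D =1 block_rev n D'.
Proof.
move=> e j; rewrite /block_rev.
have -> : block_start D j = block_start D' j.
  by elim: j => //= j ->; rewrite e.
suff -> : block_end n D j = block_end n D' j by [].
by elim: n j => //= m IH j; rewrite e IH.
Qed.

(** * Composition of two block reversals *)

Section TwoMasks.
Variables (n : nat) (D1 D2 : nat -> bool).
Hypotheses (D1n : bounded_mask n D1) (D2n : bounded_mask n D2).

(** At [k = 0] the truncated [k.-1] is [k] itself, where [D1] fails by the first clause, so only
    [D1 1] can hold. *)
Definition compatible : Prop :=
  (forall k, D1 k -> ~~ D2 k) /\
  (forall k, D2 k -> D1 k.-1 || D1 k.+1).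

Local Notation f j := (block_rev n D2 (block_rev n D1 j)).

(** Inside a [D1] block, neighbours are exchanged and [D2] does not glue them. Between the [D1]
    blocks [[l, k]] and [[k.+1, r']], the images of [l] and [r'] are compared; a descent would force
    [D2] on all of [[l, r')], including a neighbour of [k] in [D1], against disjointness. *)
Lemma compatible_desc k : compatible -> (f k.+1 < f k) = D1 k.
Proof.
move=> [disj near].
have [l [r [b hk _]]] := in_block _ _ D1n k.
have [l' [r' [b' hk' _]]] := in_block _ _ D1n k.+1.
have [_ inD startD endD] := b; have [_ inD' startD' endD'] := b'.
rewrite (block_revE _ _ D1n _ _ _ b hk) (block_revE _ _ D1n _ _ _ b' hk').
case D1k: (D1 k).
  have kr : k < r.
    rewrite ltn_neqAle; apply/andP; split; last lia.
    by apply: contraNneq endD => <-.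
  have [|<- <-] := block_uniq _ _ _ _ _ k.+1 b b' _ hk'; first lia.
  have -> : l + r - k = (l + r - k.+1).+1 by lia.
  rewrite block_rev_asc1 //; apply: disj; apply: inD; lia.
have -> : r = k.
  case: (ltngtP r k) => //; first lia.
  by move=> kr; move: D1k; rewrite inD //; lia.
have -> : l' = k.+1.
  case: (ltngtP l' k.+1) => //; last lia.
  by move=> kr; move: D1k; rewrite inD' //; lia.
have -> : l + k - k = l by lia.
have -> : k.+1 + r' - k.+1 = r' by lia.
apply/negP; rewrite block_rev_desc //; last lia.
move=> allD2; have /near /orP[] := allD2 k ltac:(lia).
  case: (posnP k) => [k0|k0 D1p]; first by rewrite k0 /= -k0 D1k.
  have /disj := D1p; rewrite allD2 //.
  suff : l != k by lia.
  by apply/eqP => lk; have := startD k.-1; rewrite D1p; lia.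
move=> D1p; have /disj := D1p; rewrite allD2 //.
suff : r' != k.+1 by lia.
by apply: contraTneq D1p => <-.
Qed.

(** Disjointness is read off mirrored pairs of a [D1] block. If [D2 k] had no neighbour in [D1],
    both [k] and [k.+1] would be singleton [D1] blocks, and [f] would descend at [k] outside
    [D1]. *)
Lemma desc_compatible :
  (forall k, k.+1 < n -> (f k.+1 < f k) = D1 k) -> compatible.
Proof.
move=> fdesc.
have disj a : D1 a -> ~~ D2 a.
  move=> D1a; have [l [r [b ha _]]] := in_block _ _ D1n a.
  have [_ inD _ endD] := b.
  have ar : a < r.
    rewrite ltn_neqAle; apply/andP; split; last lia.
    by apply: contraNneq endD => <-.
  (* The mirror image of the pair [a], [a.+1]: the first reversal sends it back to that pair in the
     opposite order. *)
  have D1k : D1 (l + r - a.+1) by apply: inD; lia.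
  have := fdesc _ (D1n _ D1k); rewrite D1k.
  rewrite !(block_revE _ _ D1n _ _ _ b); try lia.
  have -> : l + r - (l + r - a.+1).+1 = a by lia.
  have -> : l + r - (l + r - a.+1) = a.+1 by lia.
  by rewrite block_rev_asc1.
split=> // k D2k; apply/negPn/negP; rewrite negb_or => /andP[D1p D1s].
have D1k : ~~ D1 k by apply/negP => /disj; rewrite D2k.
have bk : block D1 k k by split=> // [i|i ik]; [lia|move: D1p; rewrite -ik].
have bk1 : block D1 k.+1 k.+1 by split=> // [i|i [->]]; first lia.
have := fdesc _ (D2n _ D2k).
rewrite (block_revE _ _ D1n _ _ k bk) ?(block_revE _ _ D1n _ _ k.+1 bk1); try lia.
by rewrite !addnK block_rev_desc1 // D2k (negbTE D1k).
Qed.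
End TwoMasks.

(** * Pop-stack sorting as reversal of the descent blocks *)

Definition desc_mask (s : seq nat) (k : nat) : bool :=
  (k.+1 < size s) && (nth 0 s k.+1 < nth 0 s k).

Lemma bounded_desc_mask s : bounded_mask (size s) (desc_mask s).
Proof. by move=> k /andP[]. Qed.

(** Maximality gives the end of the block: a descent at the last position of the prefix would allow
    a longer decreasing prefix. *)
Lemma dec_prefix_block (s : seq nat) : s != [::] ->
  block (desc_mask s) 0 (dec_prefix s).-1 /\ dec_prefix s <= size s.
Proof.
move=> s0; have d_gt0 := dec_prefix_gt0 s0.
have P0 : sorted gtn (take (@ord0 (size s)) s) by rewrite take0.
have [d_sorted d_max] : sorted gtn (take (dec_prefix s) s) /\
    forall i, i <= size s -> sorted gtn (take i s) -> i <= dec_prefix s.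
  rewrite /dec_prefix (bigop.bigmax_eq_arg _ P0); case: arg_maxnP => // i Pi imax.
  by split=> // j js /(imax (Ordinal (js : j < (size s).+1))).
have d_le : dec_prefix s <= size s.
  by apply/bigmax_leqP => i _; rewrite -ltnS.
split=> //; split=> //.
- move=> k hk; move/(sortedP 0) : d_sorted => /(_ k).
  rewrite size_takel // !nth_take; try lia.
  by move=> kd; apply/andP; split; [lia|apply: kd; lia].
- apply/negP => /andP[h1 h2].
  suff : (dec_prefix s).+1 <= dec_prefix s by lia.
  apply: d_max; first lia.
  apply/(sortedP 0) => i; rewrite size_takel; last lia.
  move=> hi; rewrite !nth_take; try lia.
  have [e|ne] := eqVneq i (dec_prefix s).-1; first by rewrite e.
  move/(sortedP 0) : d_sorted => /(_ i).
  rewrite size_takel // !nth_take; lia.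
Qed.

(** The second hypothesis says that the cut at [d] falls between two blocks, so no block of the
    suffix extends to the left. *)
Lemma block_drop s d l r : block (desc_mask (drop d s)) l r ->
  (d = 0 \/ ~~ desc_mask s d.-1) -> block (desc_mask s) (d + l) (d + r).
Proof.
have maskD k : desc_mask (drop d s) k = desc_mask s (d + k).
  rewrite /desc_mask size_drop !nth_drop addnS; congr (_ && _); lia.
move=> [lr inD startD endD] d_stop; split.
- lia.
- move=> k hk; have := inD (k - d); rewrite maskD subnKC; last lia.
  by apply; lia.
- move=> k hk; case: (leqP d k) => dk.
    have := startD (k - d); rewrite maskD subnKC //; apply; lia.
  case: d_stop => [|]; first lia.
  by have -> : d.-1 = k by lia.
by rewrite -maskD.
Qed.

Lemma size_pop_stack (s : seq nat) : size (pop_stack s) = size s.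
Proof.
have [m] := ubnP (size s); elim: m s => // m IH s.
have [->//|s0] := eqVneq s [::] => hs.
rewrite pop_stackE // size_cat size_rev IH -?size_cat ?cat_take_drop //.
rewrite size_drop; have := dec_prefix_gt0 s0.
by move: s0 hs; case: (s) => //= x t _; lia.
Qed.

(** Induction on the length: the first block is the decreasing prefix, and the other blocks are
    those of the remaining suffix, shifted. *)
Lemma nth_pop_stack s j : j < size s ->
  nth 0 (pop_stack s) j = nth 0 s (block_rev (size s) (desc_mask s) j).
Proof.
have [m] := ubnP (size s); elim: m s j => // m IH s j.
have [->//|s0 hs js] := eqVneq s [::].
have d_gt0 := dec_prefix_gt0 s0.
have [b d_le] := dec_prefix_block s s0.
have Dn := bounded_desc_mask s.
rewrite pop_stackE // nth_cat size_rev size_takel //.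
case: ltnP => jd.
  rewrite (block_revE _ _ Dn _ _ _ b); last lia.
  rewrite nth_rev size_takel // nth_take; last lia.
  by congr nth; lia.
have [l [r [b' hj hr]]] :=
  in_block _ _ (bounded_desc_mask (drop (dec_prefix s) s)) (j - dec_prefix s).
have b'' := block_drop _ _ _ _ b' ltac:(by case: b; right).
rewrite IH ?size_drop; try lia.
rewrite -size_drop (block_revE _ _ _ _ _ _ b' hj); last exact: bounded_desc_mask.
rewrite (block_revE _ _ Dn _ _ _ b''); last lia.
by rewrite nth_drop; congr nth; lia.
Qed.

Lemma pop_stack_mask n D s : size s = n -> bounded_mask n D ->
  desc_mask s =1 D ->
  pop_stack s = mkseq (fun j => nth 0 s (block_rev n D j)) n.
Proof.
move=> sn Dn sD; apply: (@eq_from_nth _ 0).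
  by rewrite size_pop_stack size_mkseq.
move=> j; rewrite size_pop_stack => js.
by rewrite nth_pop_stack // nth_mkseq -?sn //; congr nth; apply: eq_block_rev.
Qed.

(** * Gap words and sortable words *)

(* A gap word [g] lists the numbers of missing cells between consecutive cells
   of a polyomino.  On the side of permutations, a letter [0] is a descent of
   the permutation, a letter [1] is a descent of its image under [pop_stack]. *)
Definition letter_mask (a : nat) (g : seq nat) (k : nat) : bool :=
  nth 2 g k == a.

(** Neither end supplies a spurious [0]: at [k = 0] the letter at [k.-1] is the letter [1] itself,
    and past the end the default [2] is read. *)
Definition gap_valid (g : seq nat) : bool :=
  all (fun d => d < 3) g &&
  all (fun k => letter_mask 1 g k ==>
         letter_mask 0 g k.-1 || letter_mask 0 g k.+1) (iota 0 (size g)).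

(** The identity with the blocks of letter [1] reversed and then those of letter [0]; on positions
    the reflections compose in the opposite order. *)
Definition gap_word (g : seq nat) : seq nat :=
  mkseq (fun j => (block_rev (size g).+1 (letter_mask 1 g)
                    (block_rev (size g).+1 (letter_mask 0 g) j)).+1)
    (size g).+1.

Lemma nth_gap_word g j : j < (size g).+1 ->
  nth 0 (gap_word g) j = (block_rev (size g).+1 (letter_mask 1 g)
                           (block_rev (size g).+1 (letter_mask 0 g) j)).+1.
Proof. exact: nth_mkseq. Qed.

Lemma bounded_letter_mask a g : a < 2 ->
  bounded_mask (size g).+1 (letter_mask a g).
Proof.
move=> a2 k /eqP; case: (ltnP k (size g)) => // h.
by rewrite nth_default //; lia.
Qed.

Lemma gap_valid_compatible g : gap_valid g ->
  compatible (letter_mask 0 g) (letter_mask 1 g).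
Proof.
case/andP=> _ /allP near; split=> k; first by rewrite /letter_mask => /eqP ->.
move=> g1; have /(_ g1) kn := bounded_letter_mask 1 g isT k.
by have := near k; rewrite mem_iota g1 /=; apply; lia.
Qed.

Lemma desc_gap_word g : gap_valid g ->
  desc_mask (gap_word g) =1 letter_mask 0 g.
Proof.
move=> gv k; rewrite /desc_mask size_mkseq.
case: (ltnP k.+1) => kn; last first.
  by apply/esym/negP => /(bounded_letter_mask 0 g isT k); lia.
rewrite andTb !nth_gap_word ?ltnS //; last exact: ltnW.
by rewrite compatible_desc //; try exact: bounded_letter_mask;
   apply: gap_valid_compatible.
Qed.

(** The descent blocks are those of letter [0], so popping cancels the inner reflection, an
    involution. *)
Lemma pop_stack_gap_word g : gap_valid g ->
  pop_stack (gap_word g) =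
  mkseq (fun j => (block_rev (size g).+1 (letter_mask 1 g) j).+1) (size g).+1.
Proof.
move=> gv; have D1n := bounded_letter_mask 0 g isT.
rewrite (pop_stack_mask _ _ _ _ D1n (desc_gap_word g gv)) ?size_mkseq //.
apply: (@eq_from_nth _ 0); rewrite !size_mkseq // => j jn.
rewrite [RHS]nth_mkseq // [LHS]nth_mkseq // nth_gap_word ?block_revK //.
exact: block_rev_lt.
Qed.

Lemma desc_pop_gap_word g : gap_valid g ->
  desc_mask (pop_stack (gap_word g)) =1 letter_mask 1 g.
Proof.
move=> gv k; rewrite pop_stack_gap_word // /desc_mask size_mkseq.
have D2n := bounded_letter_mask 1 g isT.
case: (ltnP k.+1) => kn; last by apply/esym/negP => /D2n; lia.
rewrite andTb (nth_mkseq _ _ kn) (nth_mkseq _ _ (ltnW kn)) ltnS.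
by rewrite block_rev_desc1.
Qed.

Lemma gap_word_sortable g : gap_valid g ->
  pop_stack (pop_stack (gap_word g)) = iota 1 (size g).+1.
Proof.
move=> gv; have D2n := bounded_letter_mask 1 g isT.
rewrite (pop_stack_mask _ _ _ _ D2n (desc_pop_gap_word g gv));
  last by rewrite size_pop_stack size_mkseq.
apply: (@eq_from_nth _ 0); rewrite size_mkseq ?size_iota // => j jn.
rewrite nth_mkseq // pop_stack_gap_word // nth_mkseq; last exact: block_rev_lt.
by rewrite block_revK // nth_iota.
Qed.

Lemma letter_mask_inj g g' : size g = size g' ->
  all (fun d => d < 3) g -> all (fun d => d < 3) g' ->
  letter_mask 0 g =1 letter_mask 0 g' ->
  letter_mask 1 g =1 letter_mask 1 g' -> g = g'.
Proof.
move=> sg g3 g'3 e0 e1; apply: (@eq_from_nth _ 2) => // k kg.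
have := e0 k; have := e1 k; rewrite /letter_mask.
have := all_nthP 2 g3 k kg; have := all_nthP 2 g'3 k; rewrite -sg => /(_ kg).
by do 2 (case: nth => [|[|[|?]]]).
Qed.

(** Both masks are recovered, as the descents of the word and of its image under [pop_stack]. *)
Lemma gap_word_inj g g' : gap_valid g -> gap_valid g' ->
  gap_word g = gap_word g' -> g = g'.
Proof.
move=> gv g'v e; apply: letter_mask_inj.
- by have := congr1 size e; rewrite !size_mkseq => -[].
- by case/andP: gv.
- by case/andP: g'v.
- by move=> k; rewrite -!desc_gap_word // e.
- by move=> k; rewrite -!desc_pop_gap_word // e.
Qed.

(** Undoing both pops writes [s] as a double reversal of the identity with descents [D1];
    [desc_compatible] then turns the masks into a valid word. *)
Lemma sortable_gap_word n s : 0 < n -> size s = n ->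
  pop_stack (pop_stack s) = iota 1 n ->
  exists g, [/\ size g = n.-1, gap_valid g & s = gap_word g].
Proof.
move=> n0 sn sP.
set D1 := desc_mask s; set D2 := desc_mask (pop_stack s).
have D1n : bounded_mask n D1 by rewrite -sn; apply: bounded_desc_mask.
have D2n : bounded_mask n D2.
  by rewrite -sn -size_pop_stack; apply: bounded_desc_mask.
have sE j : j < n -> nth 0 s j = (block_rev n D2 (block_rev n D1 j)).+1.
  move=> jn; have j1 := block_rev_lt n D1 D1n j jn.
  have j2 := block_rev_lt n D2 D2n _ j1.
  (* Evaluating at the image of [j] under both reflections makes the involutions cancel. *)
  have := congr1 (fun t => nth 0 t (block_rev n D2 (block_rev n D1 j))) sP.
  rewrite nth_iota // nth_pop_stack size_pop_stack sn // -/D2.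
  rewrite block_revK // nth_pop_stack sn // -/D1 block_revK //.
have [disj near] : compatible D1 D2.
  apply: (desc_compatible n) => // k kn.
  have := sE k.+1 kn; have := sE k (ltnW kn).
  by rewrite /D1 /desc_mask sn kn /= => -> ->.
pose g := mkseq (fun k => if D1 k then 0 else if D2 k then 1 else 2) n.-1.
have gsz : size g = n.-1 by rewrite size_mkseq.
have g0 : letter_mask 0 g =1 D1.
  move=> k; rewrite /letter_mask; case: (ltnP k n.-1) => kn.
    by rewrite nth_mkseq //; case: (D1 k); case: (D2 k).
  by rewrite nth_default ?gsz //; apply/esym/negP => /D1n; lia.
have g1 : letter_mask 1 g =1 D2.
  move=> k; rewrite /letter_mask; case: (ltnP k n.-1) => kn.
    rewrite nth_mkseq //; case D1k: (D1 k); last by case: (D2 k).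
    by apply/esym/negbTE/disj.
  by rewrite nth_default ?gsz //; apply/esym/negP => /D2n; lia.
exists g; split=> //.
- apply/andP; split.
    by apply/allP => d /mapP[k _ ->]; case: (D1 k); case: (D2 k).
  by apply/allP => k _; rewrite !g0 g1; apply/implyP/near.
have gn : (size g).+1 = n by rewrite gsz prednK.
apply: (@eq_from_nth _ 0); first by rewrite sn size_mkseq.
rewrite sn => j jn; rewrite sE // nth_gap_word gn //; congr _.+1.
by rewrite (eq_block_rev _ _ _ g1) (eq_block_rev _ _ _ g0).
Qed.

(** Block reversals are injective, so every non-descent is an ascent. *)
Lemma asc_gap_word g : gap_valid g ->
  asc (gap_word g) = count (fun d => d != 0) g.
Proof.
move=> gv; rewrite /asc -sum1_card -sum1_count (big_nth 2) big_mkord.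
rewrite size_mkseq; apply: eq_bigl => i; rewrite inE.
rewrite -[RHS]/(~~ letter_mask 0 g i) -desc_gap_word //.
rewrite /desc_mask size_mkseq ltnS ltn_ord andTb -leqNgt ltn_neqAle.
have ig : i.+1 < (size g).+1 := ltn_ord i.
rewrite !nth_gap_word //; last exact: ltnW.
rewrite eqSS !(can_eq (block_revK _ _ _)); try exact: bounded_letter_mask.
by rewrite ltn_eqF.
Qed.

(** * Gap words as elements of ['S_n] *)

Lemma size_perm_word n (s : 'S_n) : size (perm_word s) = n.
Proof. by rewrite size_map size_enum_ord. Qed.

Lemma nth_perm_word n (s : 'S_n) (i : 'I_n) : nth 0 (perm_word s) i = (s i).+1.
Proof. by rewrite (nth_map i) ?size_enum_ord // nth_ord_enum. Qed.

Lemma perm_word_inj n : injective (@perm_word n).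
Proof.
move=> s t e; apply/permP => i; apply/val_inj/eq_add_S.
by rewrite -!nth_perm_word e.
Qed.

Lemma gap_word_perm g : exists s : 'S_(size g).+1, perm_word s = gap_word g.
Proof.
have D1n := bounded_letter_mask 0 g isT.
have D2n := bounded_letter_mask 1 g isT.
have lt_n (j : 'I_(size g).+1) : block_rev (size g).+1 (letter_mask 1 g)
    (block_rev (size g).+1 (letter_mask 0 g) j) < (size g).+1.
  by do 2 apply: block_rev_lt => //.
have f_inj : injective (fun j => Ordinal (lt_n j)).
  move=> i j /(congr1 val) /= /(can_inj (block_revK _ _ D2n)).
  by move/(can_inj (block_revK _ _ D1n)) /val_inj.
exists (perm f_inj); apply: (@eq_from_nth _ 0).
  by rewrite size_perm_word size_mkseq.
rewrite size_perm_word => i hi.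
by rewrite (nth_perm_word _ _ (Ordinal hi)) permE nth_mkseq.
Qed.

(** * Polyominoes as increasing lists of cells *)

Local Open Scope fset_scope.
Local Open Scope ring_scope.

Definition cells (x : int) (g : seq nat) : seq int :=
  x :: scanl (fun y d => y + d.+1%:Z) x g.

Definition gap_polyomino (x : int) (g : seq nat) : {fset int} :=
  [fset i in cells x g].

Lemma cells_sorted x g : sorted <%R (cells x g).
Proof.
rewrite /cells /=; elim: g x => //= d g IH x; rewrite IH andbT; lia.
Qed.

Lemma cells_uniq x g : uniq (cells x g).
Proof. exact/lt_sorted_uniq/cells_sorted. Qed.

Lemma size_cells x g : size (cells x g) = (size g).+1.
Proof. by rewrite /= size_scanl. Qed.

Lemma card_gap_polyomino x g : #|` gap_polyomino x g| = (size g).+1.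
Proof. by rewrite card_fseq undup_id ?cells_uniq // size_cells. Qed.

Lemma mem_gap_polyomino x g i : (i \in gap_polyomino x g) = (i \in cells x g).
Proof. by rewrite !inE. Qed.

Lemma gap_polyomino_eq x y g h :
  gap_polyomino x g = gap_polyomino y h -> cells x g = cells y h.
Proof.
move=> e; apply: lt_sorted_eq; rewrite ?cells_sorted // => i.
by rewrite -!mem_gap_polyomino e.
Qed.

(** Each gap is one less than a difference of consecutive cells. *)
Lemma cells_inj x y g h : cells x g = cells y h -> g = h.
Proof.
have K (t : int) : cancel (fun d => t + d.+1%:Z) (fun z => `|z - t|%N.-1).
  by move=> d /=; lia.
by case=> <- /(can_inj (scanlK K x)).
Qed.

Lemma map_cells c x g : [seq i + c | i <- cells x g] = cells (x + c) g.
Proof.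
rewrite /cells /=; congr (_ :: _); elim: g x => //= d g IH x.
by rewrite IH addrAC.
Qed.

Lemma translate_gap_polyomino c x g :
  translate c (gap_polyomino x g) = gap_polyomino (x + c) g.
Proof.
apply/fsetP => i; rewrite mem_gap_polyomino -map_cells.
apply/imfsetP/mapP => -[j /= hj ->]; exists j => //.
  by rewrite -mem_gap_polyomino.
by rewrite mem_gap_polyomino.
Qed.

Lemma sorted_cells x s : path <%R x s ->
  x :: s = cells x (pairmap (fun y z => `|z - y|%N.-1) x s).
Proof.
rewrite /cells => h; congr (_ :: _); elim: s x h => //= y s IH x /andP[xy ys].
have -> : x + (`|y - x|%N.-1.+1)%:Z = y by lia.
by rewrite -IH.
Qed.

Lemma gap_polyomino_surj A : (0 < #|` A|)%N ->
  exists x g, A = gap_polyomino x g.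
Proof.
move=> A0; have := sort_lt_sorted (enum_fset A).
have := size_sort <=%R (enum_fset A); have := mem_sort <=%R (enum_fset A).
case: sort => [_ /= e|x s sA _]; first by rewrite -e in A0.
rewrite fset_uniq /= => h.
exists x, (pairmap (fun y z => `|z - y|%N.-1) x s).
by apply/fsetP => i; rewrite mem_gap_polyomino -sorted_cells // sA.
Qed.

Lemma cells_ge x g i : i \in cells x g -> x <= i.
Proof.
have := cells_sorted x g; rewrite /cells /= lt_path_sortedE => /andP[/allP h _].
by rewrite inE => /predU1P[->//|/h/ltW].
Qed.

(** Induction removing the leftmost cell [x]: it is right-free iff the first gap is nonzero, and no
    other cell [i] has [i + 1 = x]. The extra one counts the last cell. *)
Lemma num_right_free_gap_polyomino x g :
  num_right_free (gap_polyomino x g) = (count (fun d => d != 0%N) g).+1.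
Proof.
have -> : num_right_free (gap_polyomino x g) =
    count (fun i : int => i + 1 \notin cells x g) (cells x g).
  rewrite /num_right_free -size_filter; set s := [seq i <- _ | _].
  have us : uniq s by rewrite filter_uniq ?cells_uniq.
  rewrite -(undup_id us) -card_fseq; congr #|` _|; apply/fsetP => i.
  by rewrite !inE /= mem_filter !inE andbC.
elim: g x => [|d g IH] x; first by rewrite /= inE; lia.
have -> : cells x (d :: g) = x :: cells (x + d.+1%:Z) g by [].
set t := cells (x + d.+1%:Z) g.
rewrite -[LHS]/(((x + 1)%R \notin x :: t) +
  count (fun i : int => (i + 1)%R \notin x :: t) t)%N [in RHS]/= -addnS -(IH (x + d.+1%:Z)) -/t; congr (_ + _)%N.
  congr nat_of_bool; rewrite in_cons {}/t; case: d => [|d].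
    by rewrite mem_head orbT.
  rewrite negb_or; apply/andP; split; first lia.
  by apply/negP => /cells_ge; lia.
apply: eq_in_count => i /cells_ge hi; rewrite in_cons negb_or.
by case: eqP => //; lia.
Qed.

Lemma cell_adjE w i j :
  cell_adj w i j = (`|i - j| == 1) || (`|i - j| == w%:Z).
Proof. by []. Qed.

Lemma cell_adj_sym w : symmetric (cell_adj w).
Proof. by move=> i j; rewrite !cell_adjE distrC. Qed.

(** * Connectivity in terms of gaps *)

Section Connectivity.
Variables (x : int) (g : seq nat).
Local Notation c j := (nth 0 (cells x g) j).
Local Notation gap j := (nth 2%N g j).

Lemma nth_cellsS {j} : (j < size g)%N -> c j.+1 = c j + (gap j).+1%:Z.
Proof.
rewrite /cells /=; elim: g x j => // d h IH y [|j] jh /=; first by rewrite addrC.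
by rewrite IH.
Qed.

Lemma cells_le i j : (i <= j <= size g)%N -> c i <= c j.
Proof.
move=> h; rewrite (lt_sorted_leq_nth _ (cells_sorted x g)) ?inE ?size_cells; lia.
Qed.

Lemma mem_cells {i} : i \in gap_polyomino x g ->
  exists2 j, (j <= size g)%N & i = c j.
Proof.
rewrite mem_gap_polyomino => /(nthP 0) [j]; rewrite size_cells => jg <-.
by exists j.
Qed.

Lemma nth_cells_mem {j} : (j <= size g)%N -> c j \in gap_polyomino x g.
Proof. by move=> jg; rewrite mem_gap_polyomino mem_nth // size_cells. Qed.

Local Notation adj := [rel s t : gap_polyomino x g | cell_adj 3 (val s) (val t)].

(** Consecutive cells are linked: gaps [0] and [2] are edges of length 1 and 3, and a gap [1] is
    bypassed through a neighbouring gap [0], since [1 + 2 = 3]. *)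
Lemma gap_valid_connected : gap_valid g -> cell_connected 3 (gap_polyomino x g).
Proof.
case/andP => /all_nthP g3 /allP near.
have adj_sym : connect_sym adj.
  by apply: sym_connect_sym => u v; exact: cell_adj_sym.
have adjW i j (hi : (i <= size g)%N) (hj : (j <= size g)%N) :
    cell_adj 3 (c i) (c j) ->
    connect adj [` nth_cells_mem hi] [` nth_cells_mem hj].
  by move=> ij; apply: connect1.
have step j (hj : (j <= size g)%N) (hj1 : (j.+1 <= size g)%N) :
    connect adj [` nth_cells_mem hj] [` nth_cells_mem hj1].
  have cS := nth_cellsS hj1.
  have [g1|g1] := eqVneq (gap j) 1%N; last first.
    apply: adjW; rewrite cell_adjE cS; have := g3 2%N j hj1.
    by case: (gap j) g1 => [|[|[|]]] // _ _; lia.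
  have := near j; rewrite mem_iota /letter_mask g1 /= => /(_ hj1) /orP[] /eqP g0.
    (* For [j = 0], [j.-1] is [j] itself, whose letter is [1]. *)
    case: j hj hj1 cS g1 g0 => [|j] hj hj1 cS g1 g0; first by rewrite g0 in g1.
    have hp : (j <= size g)%N by lia.
    have cp := nth_cellsS hj.
    apply: (connect_trans (y := [` nth_cells_mem hp])).
      by apply: adjW; rewrite cell_adjE cp g0; lia.
    by apply: (adjW _ _ hp hj1); rewrite cell_adjE cS cp g0 g1; lia.
  (* Past its end [g] reads as [2], so the letter [0] at [j.+1] lies within [g]. *)
  have hs : (j.+2 <= size g)%N.
    by case: ltnP => // hs; rewrite nth_default in g0.
  have cs := nth_cellsS hs.
  apply: (connect_trans (y := [` nth_cells_mem hs])).
    by apply: adjW; rewrite cell_adjE cs cS g0 g1; lia.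
  by apply: (adjW _ _ hs hj1); rewrite cell_adjE cs g0; lia.
have from0 j (hj : (j <= size g)%N) :
    connect adj [` nth_cells_mem (leq0n (size g))] [` nth_cells_mem hj].
  elim: j hj => [|j IH] hj; first by rewrite (bool_irrelevance hj (leq0n _)).
  exact: connect_trans (IH (ltnW hj)) (step _ _ _).
apply/forallP => -[u uP]; apply/forallP => -[v vP].
have [i hi ui] := mem_cells uP; have [j hj vj] := mem_cells vP.
have -> : [` uP] = [` nth_cells_mem hi] by apply: val_inj.
have -> : [` vP] = [` nth_cells_mem hj] by apply: val_inj.
by apply: connect_trans (from0 j hj); rewrite adj_sym.
Qed.

(** Without an edge across the gap, the cells up to [c j] would be closed under adjacency, although
    [c j.+1] is connected to [c j]. *)
Lemma connected_cut {j} : cell_connected 3 (gap_polyomino x g) ->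
  (j < size g)%N ->
  exists i k, [/\ (i <= j < k)%N, (k <= size g)%N & cell_adj 3 (c i) (c k)].
Proof.
move=> conn jg.
have [/existsP[u /existsP[v /and3P[uj vj uv]]]|none] :=
  boolP [exists u : gap_polyomino x g, exists v : gap_polyomino x g,
    [&& val u <= c j, c j < val v & cell_adj 3 (val u) (val v)]].
  have [i hi ui] := mem_cells (valP u); have [k hk vk] := mem_cells (valP v).
  move: uj vj uv; rewrite ui vk => uj vj uv; exists i, k; split=> //.
  have := nth_cellsS jg; have := cells_le j.+1 i; have := cells_le k j; lia.
have cl : closed adj [pred u | val u <= c j].
  apply: intro_closed => [|u v /= uv uj].
    by apply: sym_connect_sym => u v; exact: cell_adj_sym.
  rewrite inE leNgt; apply/negP => vj; case/negP: none.
  by apply/existsP; exists u; apply/existsP; exists v; apply/and3P.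
move/forallP/(_ [` nth_cells_mem (ltnW jg)])/forallP/(_ [` nth_cells_mem jg]): conn.
move=> conn; have : (c j <= c j) = (c j.+1 <= c j) := closed_connect cl conn.
by rewrite lexx (nth_cellsS jg); lia.
Qed.

(** An edge across a gap has length at most 3, which bounds the gap by 2. Across a gap [1], where
    the cells are 2 apart, it has length 3, so it starts or ends one cell beyond the pair, at
    distance 1. *)
Lemma connected_gap_valid : cell_connected 3 (gap_polyomino x g) -> gap_valid g.
Proof.
move=> conn; apply/andP; split.
  apply/(all_nthP 2%N) => j jg.
  have [i [k [hj hk]]] := connected_cut conn jg.
  have := cells_le i j; have := cells_le j.+1 k; have := nth_cellsS jg.
  rewrite cell_adjE; lia.
apply/allP => j; rewrite mem_iota /= => jg; apply/implyP => /eqP g1.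
have [i [k [hj hk adj_ik]]] := connected_cut conn jg.
have := nth_cellsS jg; rewrite g1 => cS.
have cj := cells_le i j; have cj1 := cells_le j.+1 k.
have [ij|ij] := ltnP i j.
  have jp : (j.-1 < size g)%N by lia.
  have := nth_cellsS jp; rewrite prednK; last lia.
  have := cells_le i j.-1; rewrite /letter_mask => h1 h2.
  by apply/orP; left; move: adj_ik; rewrite cell_adjE; lia.
have [jk|jk] := ltnP j.+1 k.
  have jp : (j.+1 < size g)%N by lia.
  have := nth_cellsS jp; have := cells_le j.+2 k; rewrite /letter_mask => h1 h2.
  by apply/orP; right; move: adj_ik; rewrite cell_adjE; lia.
have ei : i = j by lia. have ek : k = j.+1 by lia.
by move: adj_ik; rewrite cell_adjE ei ek cS; lia.
Qed.

End Connectivity.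

(** * Equinumerosity through gap words *)

Local Open Scope classical_set_scope.
Local Open Scope card_scope.

(** [Q] restricts the number of right-free cells, which is the number of ascents plus one: the full
    set gives the bijection, a singleton the refined count. *)
Definition gap_words (n : nat) (Q : set nat) : set (seq nat) :=
  [set g | [/\ size g = n.-1, gap_valid g & Q (count (fun d => d != 0%N) g).+1]].

Lemma image_perm_word n (Q : set nat) : (0 < n)%N ->
  @perm_word n @` [set s | s \in two_pop_stack_sortable n /\
                           Q (asc (perm_word s)).+1] =
  gap_word @` gap_words n Q.
Proof.
move=> n0; apply/seteqP; split=> y [].
  move=> s [/eqP sP Qs] <-.
  have [g [gn gv sg]] := sortable_gap_word _ _ n0 (size_perm_word _ s) sP.
  by exists g => //; split=> //; rewrite -asc_gap_word // -sg.
move=> g [gn gv Qg] <-.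
have gn' : n = (size g).+1 by rewrite gn prednK.
subst n; have [s sg] := gap_word_perm g.
exists s => //; split; last by rewrite sg asc_gap_word.
by apply/eqP; rewrite sg gap_word_sortable.
Qed.

(** Each class has a representative with leftmost cell [0]. *)
Lemma up_to_translation_gap_words n (Q : set nat) : (0 < n)%N ->
  up_to_translation [set A | polyomino 3 n A /\ Q (num_right_free A)] =
  (fun g => translation_class (gap_polyomino 0 g)) @` gap_words n Q.
Proof.
move=> n0; apply/seteqP; split=> y [].
  move=> A [[An Aconn] QA] <-.
  have A0 : (0 < #|` A|)%N by rewrite An.
  have [x [g eA]] := gap_polyomino_surj A A0; move: An Aconn QA; rewrite {}eA.
  rewrite card_gap_polyomino num_right_free_gap_polyomino => gn gc Qg.
  exists g.
    by split=> //; [rewrite -gn|exact: connected_gap_valid gc].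
  apply/seteqP; split=> _ [c ->]; rewrite translate_gap_polyomino.
    by exists (c - x); rewrite translate_gap_polyomino; congr gap_polyomino; lia.
  by exists (c + x); rewrite translate_gap_polyomino; congr gap_polyomino; lia.
move=> g [gn gv Qg] <-; exists (gap_polyomino 0 g) => //.
split; last by rewrite num_right_free_gap_polyomino.
split.
  by rewrite card_gap_polyomino gn prednK.
exact: gap_valid_connected.
Qed.

(** A translation moves the starting cell and leaves the gap word unchanged. *)
Lemma translation_class_inj g h :
  translation_class (gap_polyomino 0 g) = translation_class (gap_polyomino 0 h) ->
  g = h.
Proof.
move=> e; have : translation_class (gap_polyomino 0 g) (gap_polyomino 0 g).
  by exists 0; rewrite translate_gap_polyomino addr0.
rewrite e => -[c]; rewrite translate_gap_polyomino.
by move/gap_polyomino_eq/cells_inj.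
Qed.

(** Sortable permutations and gap words have the same image among words under injective maps; the
    translation classes are an injective image of the gap words. *)
Lemma sortable_card_polyomino n (Q : set nat) : (0 < n)%N ->
  [set s | s \in two_pop_stack_sortable n /\ Q (asc (perm_word s)).+1] #=
  up_to_translation [set A | polyomino 3 n A /\ Q (num_right_free A)].
Proof.
move=> n0; rewrite up_to_translation_gap_words //.
apply: (@card_eq_trans _ _ _ _ (gap_words n Q)); last first.
  rewrite card_eq_sym; apply: inj_card_eq => g h _ _.
  exact: translation_class_inj.
apply: (@card_eq_trans _ _ _ _ (gap_word @` gap_words n Q)).
  rewrite -image_perm_word // card_eq_sym; apply: inj_card_eq => s t _ _.
  exact: perm_word_inj.
apply: inj_card_eq => g h /set_mem[_ gv _] /set_mem[_ hv _].
exact: gap_word_inj.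
Qed.

Theorem theorem6 (n : nat) (hn : (0 < n)%N) :
  [set` two_pop_stack_sortable n] #= up_to_translation (polyomino 3 n)
  /\ (forall k : nat,
        up_to_translation
          [set A : {fset int} | polyomino 3 n A /\ num_right_free A = k.+1]
        #= `I_(a n k)).
Proof.
split.
  have := sortable_card_polyomino n setT hn.
  have -> : [set A | polyomino 3 n A /\ setT (num_right_free A)] = polyomino 3 n.
    by apply/seteqP; split=> A // [].
  suff -> : [set` two_pop_stack_sortable n] =
    [set s | s \in two_pop_stack_sortable n /\ setT (asc (perm_word s)).+1] by [].
  by apply/seteqP; split=> s // [].
move=> k; rewrite card_eq_sym.
apply: card_eq_trans (sortable_card_polyomino n [set r | r = k.+1] hn).
rewrite card_eq_sym; set P := [pred s : 'S_n | (s \in two_pop_stack_sortable n)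
                                && (asc (perm_word s) == k)].
(* As a finite set, the left side has [a n k] elements by definition. *)
have -> : [set s | s \in two_pop_stack_sortable n /\
                   [set r | r = k.+1] (asc (perm_word s)).+1] =
          [set` [fset s in P]%fset].
  apply/seteqP; split=> s /=; rewrite !inE.
    by case=> -> [->] /=.
  by case/andP=> -> /eqP ->.
by apply/card_eq_fsetP; rewrite card_imfset //= -cardE.
Qed.
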